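(* For all integers $n\geq 0$, $$a_{1^{4}2^{-2}4^{-1}}(2n)>0,\qquad a_{1^{4}2^{-2}4^{-1}}(4n+1)<0,\qquad a_{1^{4}2^{-2}4^{-1}}(4n+3)=0.$$
   Context: For $|q|<1$ (or as formal power series in $q$) let $f_j:=(q^j;q^j)_\infty=\prod_{k\ge 1}(1-q^{jk})$ for each positive integer $j$. The integers $a_{1^{4}2^{-2}4^{-1}}(n)$, $n\ge 0$, are defined by $\sum_{n=0}^\infty a_{1^{4}2^{-2}4^{-1}}(n)q^n=\dfrac{f_1^4}{f_2^2f_4}$. *)

(* Defs.v *)
From HB Require Import structures.
From mathcomp Require Import all_boot all_order all_algebra.
From mathcomp Require Import boolp.

Set Implicit Arguments.
Unset Strict Implicit.
Unset Printing Implicit Defensive.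

Import Order.TTheory GRing.Theory Num.Theory.
Local Open Scope ring_scope.

(* Formal power series R[[q]], with the Cauchy product. *)

Record fps (R : Type) := Fps { fpscoef : nat -> R }.

Notation "s .[[ n ]]" := (fpscoef s n)
  (at level 1, left associativity, format "s .[[ n ]]") : ring_scope.

Lemma fpsP (R : Type) (f g : fps R) : (forall n, f.[[n]] = g.[[n]]) -> f = g.
Proof. by case: f g => f [g] /= /funext ->. Qed.

HB.instance Definition _ (R : Type) := gen_eqMixin (fps R).
HB.instance Definition _ (R : Type) := gen_choiceMixin (fps R).

Section FpsRing.
Variable R : comUnitRingType.
Implicit Types f g h : fps R.

Definition fps_zero : fps R := Fps (fun=> 0).
Definition fps_opp f : fps R := Fps (fun n => - f.[[n]]).
Definition fps_add f g : fps R := Fps (fun n => f.[[n]] + g.[[n]]).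
Definition fps_one : fps R := Fps (fun n => (n == 0%N)%:R).
Definition fps_mul f g : fps R :=
  Fps (fun n => \sum_(i < n.+1) f.[[i]] * g.[[n - i]]).

Fact fps_addA : associative fps_add.
Proof. by move=> f g h; apply: fpsP => n /=; rewrite addrA. Qed.
Fact fps_addC : commutative fps_add.
Proof. by move=> f g; apply: fpsP => n /=; rewrite addrC. Qed.
Fact fps_add0 : left_id fps_zero fps_add.
Proof. by move=> f; apply: fpsP => n /=; rewrite add0r. Qed.
Fact fps_addN : left_inverse fps_zero fps_opp fps_add.
Proof. by move=> f; apply: fpsP => n /=; rewrite addNr. Qed.

HB.instance Definition _ :=
  GRing.isZmodule.Build (fps R) fps_addA fps_addC fps_add0 fps_addN.

Let trunc m f : {poly R} := \poly_(i < m.+1) f.[[i]].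

Let coef_trunc m f n : (n <= m)%N -> (trunc m f)`_n = f.[[n]].
Proof. by move=> le_nm; rewrite coef_poly ltnS le_nm. Qed.

Let fps_mulE m f g n :
  (n <= m)%N -> (fps_mul f g).[[n]] = (trunc m f * trunc m g)`_n.
Proof.
move=> le_nm; rewrite coefM; apply: eq_bigr => i _.
have le_in : (i <= n)%N by rewrite -ltnS.
by rewrite !coef_trunc ?(leq_trans _ le_nm) ?leq_subr.
Qed.

Fact fps_mulC : commutative fps_mul.
Proof. by move=> f g; apply: fpsP => n; rewrite !(@fps_mulE n) // mulrC. Qed.

Fact fps_mulA : associative fps_mul.
Proof.
move=> f g h; apply: fpsP => n; rewrite !(@fps_mulE n) //.
transitivity ((trunc n f * (trunc n g * trunc n h))`_n).
  rewrite !coefM; apply: eq_bigr => i _; congr (_ * _).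
  by rewrite coef_trunc ?leq_subr // (@fps_mulE n) ?leq_subr.
rewrite mulrA !coefM; apply: eq_bigr => i _; congr (_ * _).
have le_in : (i <= n)%N by rewrite -ltnS.
by rewrite coef_trunc // (@fps_mulE n).
Qed.

Fact fps_mul1 : left_id fps_one fps_mul.
Proof.
move=> f; apply: fpsP => n /=.
rewrite big_ord_recl /= subn0 mul1r big1 ?addr0 // => i _.
by rewrite mul0r.
Qed.

Fact fps_mulDl : left_distributive fps_mul fps_add.
Proof.
move=> f g h; apply: fpsP => n /=; rewrite -big_split /=.
by apply: eq_bigr => i _; rewrite mulrDl.
Qed.

Fact fps_one_neq0 : fps_one != 0 :> fps R.
Proof.
apply/eqP => /(congr1 (fun f : fps R => f.[[0]])) /= /eqP.
by rewrite oner_eq0.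
Qed.

HB.instance Definition _ :=
  GRing.Zmodule_isComNzRing.Build (fps R)
    fps_mulA fps_mulC fps_mul1 fps_mulDl fps_one_neq0.

Lemma coef_fps0 n : (0 : fps R).[[n]] = 0. Proof. by []. Qed.
Lemma coef_fps1 n : (1 : fps R).[[n]] = (n == 0%N)%:R. Proof. by []. Qed.
Lemma coef_fpsD f g n : (f + g).[[n]] = f.[[n]] + g.[[n]]. Proof. by []. Qed.
Lemma coef_fpsN f n : (- f).[[n]] = - f.[[n]]. Proof. by []. Qed.
Lemma coef_fpsB f g n : (f - g).[[n]] = f.[[n]] - g.[[n]]. Proof. by []. Qed.
Lemma coef_fpsM f g n :
  (f * g).[[n]] = \sum_(i < n.+1) f.[[i]] * g.[[n - i]].
Proof. by []. Qed.

Lemma coef_fps0M f g : (f * g).[[0]] = f.[[0]] * g.[[0]].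
Proof. by rewrite coef_fpsM big_ord_recl big_ord0 addr0. Qed.

(* The units are the series with invertible constant term. The first n + 1
   coefficients of the inverse solve f * g = 1 degree by degree. *)
Fixpoint fps_inv_seq f n : seq R :=
  if n is n'.+1 then
    let s := fps_inv_seq f n' in
    rcons s (- f.[[0]]^-1 * \sum_(i < n) f.[[n - i]] * s`_i)
  else [:: f.[[0]]^-1].

Definition fps_unit : {pred fps R} := [pred f | f.[[0]] \is a GRing.unit].

Definition fps_inv f : fps R :=
  if f \in fps_unit then Fps (fun n => (fps_inv_seq f n)`_n) else f.

Let size_inv_seq f n : size (fps_inv_seq f n) = n.+1.
Proof. by elim: n => //= n IHn; rewrite size_rcons IHn. Qed.

Let nth_inv_seq f n i :
  (i <= n)%N -> (fps_inv_seq f n)`_i = (fps_inv_seq f i)`_i.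
Proof.
elim: n => [|n IHn]; first by rewrite leqn0 => /eqP ->.
rewrite leq_eqVlt => /predU1P[-> //|lt_in] /=.
by rewrite nth_rcons size_inv_seq lt_in IHn.
Qed.

Fact fps_mulV : {in fps_unit, left_inverse 1 fps_inv *%R}.
Proof.
move=> f Uf; have Uf0 : f.[[0]] \is a GRing.unit by [].
rewrite /fps_inv Uf mulrC; apply: fpsP => -[|n].
  by rewrite coef_fps0M /= divrr.
rewrite coef_fpsM big_ord_recl [RHS]/= subn0.
rewrite [X in f.[[_]] * X]/= nth_rcons size_inv_seq ltnn eqxx.
rewrite mulNr mulrN mulVKr; last exact: Uf0.
apply/eqP; rewrite addrC subr_eq0; apply/eqP.
rewrite (reindex_inj rev_ord_inj) /=; apply: eq_bigr => i _.
have le_in : (i <= n)%N by rewrite -ltnS.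
by rewrite /bump /= add1n !subSS subKn // subSn // (@nth_inv_seq f n i).
Qed.

Fact fps_unitPl f g : g * f = 1 -> fps_unit f.
Proof.
move=> /(congr1 (fun h : fps R => h.[[0]])); rewrite coef_fps0M /= => gf1.
by apply/unitrPr; exists g.[[0]]; rewrite mulrC.
Qed.

Fact fps_inv_out : {in [predC fps_unit], fps_inv =1 id}.
Proof. by move=> f nUf; rewrite /fps_inv ifN. Qed.

HB.instance Definition _ :=
  GRing.ComNzRing_hasMulInverse.Build (fps R)
    fps_mulV fps_unitPl fps_inv_out.

Lemma fps_unitE f : (f \is a GRing.unit) = (f.[[0]] \is a GRing.unit).
Proof. by []. Qed.

Definition fpsX : fps R := Fps (fun n => (n == 1%N)%:R).

Lemma coef_fpsXn m n : (fpsX ^+ m).[[n]] = (n == m)%:R.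
Proof.
elim: m n => [|m IHm] n; first by rewrite expr0.
rewrite exprS coef_fpsM; case: n => [|n].
  by rewrite big_ord_recl big_ord0 mul0r addr0.
rewrite big_ord_recl mul0r add0r big_ord_recl mul1r big1 ?addr0 => [|i _].
  by rewrite IHm subSS subn0 eqSS.
by rewrite mul0r.
Qed.

Lemma coef_fpsMXn f m n :
  (f * fpsX ^+ m).[[n]] = if (n < m)%N then 0 else f.[[n - m]].
Proof.
rewrite mulrC coef_fpsM; case: ltnP => [lt_nm | le_mn].
  rewrite big1 // => i _; rewrite coef_fpsXn.
  by rewrite ltn_eqF ?mul0r // (leq_ltn_trans _ lt_nm) // -ltnS.
rewrite (bigD1 (Ordinal (le_mn : (m < n.+1)%N))) //= coef_fpsXn eqxx mul1r.
rewrite big1 ?addr0 // => i; rewrite -val_eqE /= coef_fpsXn => /negbTE ->.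
by rewrite mul0r.
Qed.

End FpsRing.

Notation "''q'" := (@fpsX int) : ring_scope.

Definition eulerf_part (j N : nat) : fps int :=
  \prod_(1 <= k < N.+1) (1 - 'q ^+ (j * k)).

Lemma eulerf_partS (j N : nat) :
  eulerf_part j N.+1 = eulerf_part j N * (1 - 'q ^+ (j * N.+1)).
Proof. by rewrite /eulerf_part big_nat_recr. Qed.

(* f_j = (q^j; q^j)_oo for 0 < j: the coefficient of q^n in the infinite
   product is that of its n-th partial product, since by eulerf_part_stable
   it no longer changes in the later ones. *)
Definition eulerf (j : nat) : fps int := Fps (fun n => (eulerf_part j n).[[n]]).

Lemma eulerf_part_stable (j n N : nat) : (0 < j)%N -> (n <= N)%N ->
  (eulerf_part j N).[[n]] = (eulerf j).[[n]].
Proof.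
move=> j_gt0; elim: N => [|N IHN]; first by rewrite leqn0 => /eqP ->.
rewrite leq_eqVlt => /predU1P[-> //|lt_nN]; rewrite -IHN //.
rewrite eulerf_partS mulrBr mulr1 coef_fpsB coef_fpsMXn.
by rewrite (leq_trans lt_nN) ?leq_pmull // subr0.
Qed.

Lemma coef_eulerf0 (j : nat) : (eulerf j).[[0]] = 1.
Proof. by rewrite /= /eulerf_part big_geq. Qed.

Lemma eulerf_unit (j : nat) : eulerf j \is a GRing.unit.
Proof. by rewrite fps_unitE coef_eulerf0 unitr1. Qed.

Definition a_1p4_2m2_4m1 (n : nat) : int :=
  (eulerf 1 ^+ 4 / (eulerf 2 ^+ 2 * eulerf 4)).[[n]].

(* Main.v *)
(** Since [f_1^2 / f_2] is Gauss' theta series [sum_(s in Z) (-1)^s q^(s^2)],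
    the coefficient of [q^n] in its square is [(-1)^n r_2(n)], with [r_2(n)] the
    number of representations of [n] as a sum of two squares. Dividing by [f_4]
    convolves this with a sequence that is positive at the multiples of 4 and
    zero elsewhere, so the result has sign [(-1)^n], and vanishes if
    [n = 3 mod 4] since then [r_2(n - 4k) = 0] for all [k].
    Gauss' identity is obtained from a finite telescoping identity in the style
    of Shanks: with [e_n = (-q;q)_n / (q;q)_n],
      [e_n * sum_(|s| <= n) (-1)^s q^(s^2)
         = 1 + 2 sum_(1 <= s <= n) (-1)^s q^(s(n+1)) (-q;q)_(s-1) / (q;q)_s]. *)

Require Import Defs.
From mathcomp Require Import all_boot all_order all_algebra.
From mathcomp Require Import zify ring.

Set Implicit Arguments.
Unset Strict Implicit.
Unset Printing Implicit Defensive.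

Import Order.TTheory GRing.Theory Num.Theory.
Local Open Scope ring_scope.

(** * Congruence of power series modulo [q^(n+1)] *)

Definition fps_eqmod (n : nat) (f g : fps int) :=
  forall i, (i <= n)%N -> f.[[i]] = g.[[i]].

Lemma fps_eqmodM n f f' g g' :
  fps_eqmod n f f' -> fps_eqmod n g g' -> fps_eqmod n (f * g) (f' * g').
Proof.
move=> Ef Eg i le_in; rewrite !coef_fpsM; apply: eq_bigr => j _.
have le_ji : (j <= i)%N by rewrite -ltnS.
by rewrite Ef ?Eg // ?(leq_trans _ le_in) ?leq_subr.
Qed.

Lemma fps_eqmodMl n h f g : fps_eqmod n f g -> fps_eqmod n (h * f) (h * g).
Proof. exact: fps_eqmodM. Qed.

(** Multiplying the congruence by [f^-1 / g] turns its two sides into [g^-1] and [f^-1]. *)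
Lemma fps_eqmod_inv n f g : f \is a GRing.unit -> g \is a GRing.unit ->
  fps_eqmod n f g -> fps_eqmod n f^-1 g^-1.
Proof.
move=> Uf Ug Efg i le_in.
have := @fps_eqmodMl n (f^-1 / g) _ _ Efg i le_in.
by rewrite divrK // mulrAC mulVr // mul1r => ->.
Qed.

Lemma subr1_qXn_unit k : (0 < k)%N -> 1 - 'q ^+ k \is a GRing.unit.
Proof.
by case: k => // k _; rewrite fps_unitE coef_fpsB coef_fpsXn subr0 unitr1.
Qed.

Lemma eulerf_part_unit j N : (0 < j)%N -> eulerf_part j N \is a GRing.unit.
Proof.
by move=> j_gt0; rewrite fps_unitE eulerf_part_stable // coef_eulerf0 unitr1.
Qed.

Lemma eulerf_part_eqmod j N : (0 < j)%N ->
  fps_eqmod N (eulerf_part j N) (eulerf j).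
Proof. by move=> j_gt0 i le_iN; apply: eulerf_part_stable. Qed.

(** * Shanks' finite identity *)

Definition negq_poch (N : nat) : fps int :=
  \prod_(1 <= k < N.+1) (1 + 'q ^+ k).

Lemma negq_pochS N : negq_poch N.+1 = negq_poch N * (1 + 'q ^+ N.+1).
Proof. by rewrite /negq_poch big_nat_recr. Qed.

Lemma eulerf_part1_negq_poch N :
  eulerf_part 1 N * negq_poch N = eulerf_part 2 N.
Proof.
elim: N => [|N IHN]; first by rewrite /eulerf_part /negq_poch !big_geq ?mulr1.
rewrite !eulerf_partS negq_pochS -IHN mul1n mulnC exprM; ring.
Qed.

Definition poch_ratio (N : nat) : fps int := negq_poch N / eulerf_part 1 N.

Lemma poch_ratio0 : poch_ratio 0 = 1.
Proof. by rewrite /poch_ratio /eulerf_part /negq_poch !big_geq // divr1. Qed.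

Lemma poch_ratioS N :
  poch_ratio N.+1 = poch_ratio N * (1 + 'q ^+ N.+1) / (1 - 'q ^+ N.+1).
Proof.
rewrite /poch_ratio negq_pochS eulerf_partS mul1n.
rewrite invrM ?eulerf_part_unit ?subr1_qXn_unit //.
by rewrite [_^-1 * _^-1]mulrC mulrA; congr (_ * _); rewrite mulrAC.
Qed.

(** The factor 2 comes from pairing [s] with [-s] in the sum over [|s| <= N]. *)
Definition theta_part (N : nat) : fps int :=
  1 + \sum_(1 <= s < N.+1) 2 * (-1) ^+ s * 'q ^+ (s ^ 2).

Lemma theta_partS N :
  theta_part N.+1 = theta_part N + 2 * (-1) ^+ N.+1 * 'q ^+ (N.+1 ^ 2).
Proof. by rewrite /theta_part big_nat_recr //= addrA. Qed.

(** For [s > 0] this is [2 (-q;q)_(s-1) / (q;q)_s]; the value 1 at [s = 0] absorbs the leading 1 of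
    the identity. *)
Definition shanks_coef (s : nat) : fps int :=
  if s is s'.+1 then 2 * poch_ratio s' / (1 - 'q ^+ s) else 1.

Definition shanks_sum (n : nat) : fps int :=
  \sum_(s < n.+1) (-1) ^+ s * shanks_coef s * 'q ^+ (s * n.+1).

(** Meant for [y = q^(n+1)], where the summand compares the terms of [shanks_sum n.+1] and
    [shanks_sum n]. Keeping [y] free decouples it from the upper limit [m], on which the induction
    runs. *)
Lemma shanks_telescope (y : fps int) m :
  \sum_(s < m.+1) (-1) ^+ s * shanks_coef s *
     ((1 - y) * ('q ^+ s * y ^+ s) - (1 + y) * y ^+ s)
  = - 2 * (-1) ^+ m * poch_ratio m * y ^+ m.+1.
Proof.
elim: m => [|m IHm].
  by rewrite big_ord1 poch_ratio0 /= !expr0; ring.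
rewrite big_ord_recr /= {}IHm poch_ratioS.
have UX := @subr1_qXn_unit m.+1 isT.
move: (mulVr UX); set u := _^-1; set x := 'q ^+ m.+1 => ux1.
rewrite !exprS; move: ((-1) ^+ m) (poch_ratio m) (y ^+ m) => a e z.
(* [ring] does not know that [u] inverts [1 - x], so the product [u * (1 - x)] is exposed first and
   then replaced by 1. *)
transitivity (-2 * a * e * y * z + (-1 * a * (2 * e)) *
  (- (u * (1 - x)) - u * (1 + x) * y) * (y * z)); first by ring.
by rewrite ux1; ring.
Qed.

(** The telescoped sum contributes [q^((n+1)^2)] and the new term [s = n+1] contributes [q^(n+1)]
    times that, with equal coefficients; together they yield the factor [1 + q^(n+1)]. *)
Lemma shanks_sumS n :
  (1 - 'q ^+ n.+1) * shanks_sum n.+1 = (1 + 'q ^+ n.+1) *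
    (shanks_sum n + 2 * (-1) ^+ n.+1 * 'q ^+ (n.+1 ^ 2) * poch_ratio n).
Proof.
have UX := @subr1_qXn_unit n.+1 isT.
have := shanks_telescope ('q ^+ n.+1) n.
rewrite (eq_bigr (fun s : 'I_n.+1 =>
    (1 - 'q ^+ n.+1) * ((-1) ^+ s * shanks_coef s * 'q ^+ (s * n.+2)) -
    (1 + 'q ^+ n.+1) * ((-1) ^+ s * shanks_coef s * 'q ^+ (s * n.+1))));
  last first.
  move=> s _; have -> : (s * n.+2 = s + n.+1 * s)%N by lia.
  rewrite [(s * n.+1)%N]mulnC exprD exprM; ring.
rewrite sumrB -!mulr_sumr -/(shanks_sum n) => /(canRL (subrK _)) telE.
rewrite [shanks_sum n.+1]big_ord_recr /= mulrDr {}telE.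
rewrite (_ : (n.+1 * n.+2 = n.+1 + n.+1 ^ 2)%N); last by lia.
rewrite exprD -exprM (_ : (n.+1 * n.+1 = n.+1 ^ 2)%N); last by lia.
move: (mulVr UX); set u := _^-1; set x := 'q ^+ n.+1 => ux1.
rewrite exprS; set y := 'q ^+ _; set a := _ ^+ n; set e := poch_ratio n.
set S := shanks_sum n.
transitivity (- 2 * a * e * y + (1 + x) * S
  - 2 * a * e * x * y * (u * (1 - x))); first by ring.
by rewrite ux1; ring.
Qed.

(** Both sides obey the recurrence [shanks_sumS], because [(1 - q^(n+1)) e_(n+1) = (1 + q^(n+1))
    e_n]. *)
Lemma shanks_identity n : shanks_sum n = poch_ratio n * theta_part n.
Proof.
elim: n => [|n IHn].
  rewrite /shanks_sum big_ord1 /theta_part big_geq // poch_ratio0 /=.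
  by rewrite expr0 addr0 !mulr1.
have UX := @subr1_qXn_unit n.+1 isT.
apply: (mulrI UX); rewrite shanks_sumS IHn poch_ratioS theta_partS.
by rewrite [RHS]mulrA [X in _ = X * _]mulrCA divrr // mulr1; ring.
Qed.

Lemma shanks_sum_eqmod n : fps_eqmod n (shanks_sum n) 1.
Proof.
move=> i le_in; rewrite [shanks_sum n]big_ord_recl coef_fpsD.
rewrite -[RHS]addr0; congr (_.[[_]] + _).
  by rewrite /= !mulr1.
apply: (big_ind (fun f : fps int => f.[[i]] = 0)) => // [f g|s _].
  by rewrite coef_fpsD => -> ->; rewrite addr0.
by rewrite coef_fpsMXn lift0 mulSn ifT // (leq_trans _ (leq_addr _ _)).
Qed.

(** * Gauss' identity, and the signs and support of the theta coefficients *)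

Lemma gauss_theta_eqmod n :
  fps_eqmod n (eulerf 1 ^+ 2 / eulerf 2) (theta_part n).
Proof.
have U1 := @eulerf_part_unit 1 n isT.
have U2 := eulerf_unit 2.
have E1 := @eulerf_part_eqmod 1 n isT.
have E2 := @eulerf_part_eqmod 2 n isT.
have P_theta : eulerf_part 1 n * shanks_sum n = negq_poch n * theta_part n.
  by rewrite shanks_identity /poch_ratio mulrA mulrCA divrr // mulr1.
(* A second factor [(q;q)_n] turns [(-q;q)_n] into [(q^2;q^2)_n]; modulo [q^(n+1)] the Shanks sum is
   1 and the finite products are [f_1] and [f_2]. *)
have part2 : eulerf_part 1 n ^+ 2 * shanks_sum n
    = eulerf_part 2 n * theta_part n.
  by rewrite expr2 -mulrA P_theta mulrA eulerf_part1_negq_poch.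
have sq : fps_eqmod n (eulerf 1 ^+ 2) (eulerf 2 * theta_part n).
  move=> i le_in; rewrite expr2 -(fps_eqmodM E1 E1) // -expr2.
  rewrite -[_ ^+ 2]mulr1 -(fps_eqmodMl _ (@shanks_sum_eqmod n)) // part2.
  by apply: (@fps_eqmodM n).
move=> i le_in; rewrite (@fps_eqmodM n _ _ _ (eulerf 2)^-1 sq) //.
by rewrite mulrAC divrr // mul1r.
Qed.

Lemma coef_fps_sign k (f : fps int) i :
  ((-1) ^+ k * f).[[i]] = (-1) ^+ k * f.[[i]].
Proof.
by rewrite -signr_odd -[in RHS]signr_odd; case: (odd k); rewrite ?mulN1r ?mul1r.
Qed.

Lemma coef_theta_partS n i : (theta_part n.+1).[[i]] =
  (theta_part n).[[i]] + 2 * (-1) ^+ n.+1 * (i == n.+1 ^ 2)%N%:R.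
Proof.
(* The factor 2 is split into a sum so that additivity and [coef_fps_sign] give the coefficients. *)
have -> : theta_part n.+1 = theta_part n +
    ((-1) ^+ n.+1 * 'q ^+ (n.+1 ^ 2) + (-1) ^+ n.+1 * 'q ^+ (n.+1 ^ 2)).
  by rewrite theta_partS; ring.
by rewrite !coef_fpsD !coef_fps_sign coef_fpsXn; ring.
Qed.

Lemma coef_theta_part0 i : (theta_part 0).[[i]] = (i == 0)%N%:R.
Proof. by rewrite /theta_part big_geq // addr0. Qed.

Lemma coef_theta_part_sign n i : 0 <= (-1) ^+ i * (theta_part n).[[i]].
Proof.
elim: n => [|n IHn]; first by rewrite coef_theta_part0; case: i => [|i];
  rewrite ?mulr0.
rewrite coef_theta_partS mulrDr addr_ge0 //.
case: eqP => [->|_]; last by rewrite !mulr0.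
(* A number and its square have the same parity. *)
have -> : (-1) ^+ (n.+1 ^ 2) = (-1) ^+ n.+1 :> int.
  by rewrite -[RHS]signr_odd -[LHS]signr_odd oddX.
by rewrite mulr1 mulrCA -expr2 sqrr_sign.
Qed.

Lemma coef_theta_part_square n i :
  (theta_part n).[[i]] != 0 -> exists x, i = (x ^ 2)%N.
Proof.
elim: n => [|n IHn].
  by rewrite coef_theta_part0; case: i => // _; exists 0%N.
rewrite coef_theta_partS; case: (i =P n.+1 ^ 2)%N => [-> _|_]; first by exists n.+1.
by rewrite mulr0 addr0.
Qed.

Definition gauss_theta : fps int := eulerf 1 ^+ 2 / eulerf 2.

Lemma coef_gauss_theta_sign i : 0 <= (-1) ^+ i * gauss_theta.[[i]].
Proof. by rewrite (@gauss_theta_eqmod i) // coef_theta_part_sign. Qed.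

Lemma coef_gauss_theta_square i :
  gauss_theta.[[i]] != 0 -> exists x, i = (x ^ 2)%N.
Proof. by rewrite (@gauss_theta_eqmod i) //; apply: coef_theta_part_square. Qed.

Lemma coef_gauss_theta0 : gauss_theta.[[0]] = 1.
Proof. by rewrite (@gauss_theta_eqmod 0) // coef_theta_part0. Qed.

Lemma coef_gauss_theta1 : gauss_theta.[[1]] = - 2.
Proof.
by rewrite (@gauss_theta_eqmod 1) // coef_theta_partS coef_theta_part0.
Qed.

(** * The square of the theta series and sums of two squares *)

Lemma coef_gauss_theta_sqr_sign i :
  (-1) ^+ i * (gauss_theta ^+ 2).[[i]] = \sum_(j < i.+1)
    ((-1) ^+ j * gauss_theta.[[j]]) *
    ((-1) ^+ (i - j) * gauss_theta.[[i - j]]).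
Proof.
rewrite expr2 coef_fpsM mulr_sumr; apply: eq_bigr => j _.
have le_ji : (j <= i)%N by rewrite -ltnS.
have -> : (-1) ^+ i = (-1) ^+ j * (-1) ^+ (i - j) :> int.
  by rewrite -exprD subnKC.
by ring.
Qed.

Lemma coef_gauss_theta_sqr_ge0 i : 0 <= (-1) ^+ i * (gauss_theta ^+ 2).[[i]].
Proof.
rewrite coef_gauss_theta_sqr_sign sumr_ge0 // => j _.
by rewrite mulr_ge0 ?coef_gauss_theta_sign.
Qed.

Lemma coef_gauss_theta_sqr_gt0 i :
  (i < 3)%N -> 0 < (-1) ^+ i * (gauss_theta ^+ 2).[[i]].
Proof.
rewrite coef_gauss_theta_sqr_sign.
pose t j : int := (-1) ^+ j * gauss_theta.[[j]].
have t0 : t 0 = 1 by rewrite /t coef_gauss_theta0 mulr1.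
have t1 : t 1 = 2 by rewrite /t coef_gauss_theta1.
(* A bound suffices here: in degree 2 the middle term [t 1 * t 1] is already positive. *)
have t2 : 0 <= t 2 := coef_gauss_theta_sign 2.
rewrite -[X in _ -> 0 < X]/(\sum_(j < i.+1) t j * t (i - j)%N).
move: t t0 t1 t2 => t t0 t1 t2.
case: i => [|[|[|?] ] ] // _; rewrite !big_ord_recl big_ord0 /= /bump /=
  ?t0 ?t1 //.
by rewrite mul1r mulr1 addr0 ltr_wpDl // ltr_wpDr.
Qed.

(** Squares are 0 or 1 modulo 4. *)
Lemma sum_two_squares_mod4 x y : (x ^ 2 + y ^ 2)%N <> 3 %[mod 4].
Proof.
rewrite -modnDm -(modnXm 2 4 x) -(modnXm 2 4 y).
by have := ltn_pmod x (isT : 0 < 4)%N; have := ltn_pmod y (isT : 0 < 4)%N;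
  case: (x %% 4)%N => [|[|[|[|?] ] ] ] //; case: (y %% 4)%N => [|[|[|[|?] ] ] ] //.
Qed.

Lemma coef_gauss_theta_sqr_mod4 i :
  (i %% 4 = 3)%N -> (gauss_theta ^+ 2).[[i]] = 0.
Proof.
move=> i4; rewrite expr2 coef_fpsM big1 // => j _.
have le_ji : (j <= i)%N by rewrite -ltnS.
apply/eqP; rewrite mulf_eq0; apply/negPn/negP; rewrite negb_or => /andP[].
move=> /coef_gauss_theta_square[x jE] /coef_gauss_theta_square[y ijE].
by apply: (@sum_two_squares_mod4 x y); rewrite -jE -ijE subnKC.
Qed.

(** * Positivity of the coefficients of [1 / f_4] *)

Definition pos_on_mult4 (f : fps int) :=
  forall i, if (4 %| i)%N then is_true (0 < f.[[i]]) else f.[[i]] = 0.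

(** The quotient [g] satisfies [g = f + q^m g], which permits strong induction on the degree. *)
Lemma coef_fps_div_subr1_qXn (f : fps int) m i : (0 < m)%N ->
  (f / (1 - 'q ^+ m)).[[i]] =
  f.[[i]] + (if (i < m)%N then 0 else (f / (1 - 'q ^+ m)).[[i - m]]).
Proof.
move=> m_gt0; rewrite -coef_fpsMXn -coef_fpsD; congr (_.[[_]]).
by rewrite -[X in _ = X + _](divrK (subr1_qXn_unit m_gt0)); ring.
Qed.

(** At least one factor is required, since the empty product has coefficient 0 at 4. The factor
    [1 / (1 - q^4)] is positive at every multiple of 4, and later factors only add nonnegative
    amounts there. *)
Lemma eulerf_part4_inv_pos N : pos_on_mult4 (eulerf_part 4 N.+1)^-1.
Proof.
elim: N => [|N IHN].
  have -> : (eulerf_part 4 1)^-1 = 1 / (1 - 'q ^+ 4).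
    by rewrite eulerf_partS /eulerf_part big_geq // !mul1r.
  elim/ltn_ind => i IHi; rewrite coef_fps_div_subr1_qXn // coef_fps1.
  case: ltnP => [|le4i].
    by case: i IHi => [|[|[|[|?] ] ] ] //.
  have lt_i : (i - 4 < i)%N by lia.
  have -> : (i == 0)%N = false by lia.
  rewrite add0r; have := IHi _ lt_i.
  by have -> : (4 %| i - 4)%N = (4 %| i)%N by lia.
have U1 := @eulerf_part_unit 4 N.+1 isT.
have U2 := @subr1_qXn_unit (4 * N.+2) isT.
rewrite eulerf_partS invrM // mulrC.
elim/ltn_ind => i IHi; rewrite coef_fps_div_subr1_qXn //.
case: ltnP => [_|le_mi]; first by rewrite addr0; apply: IHN.
have lt_i : (i - 4 * N.+2 < i)%N by lia.
have := IHi _ lt_i.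
have -> : (4 %| i - 4 * N.+2)%N = (4 %| i)%N by lia.
by have := IHN i; case: ifP => _; [apply: addr_gt0 | move=> -> ->].
Qed.

Lemma eulerf4_inv_pos : pos_on_mult4 (eulerf 4)^-1.
Proof.
move=> i; have := eulerf_part4_inv_pos i i.
have E := @eulerf_part_eqmod 4 i.+1 isT.
by rewrite (fps_eqmod_inv (eulerf_part_unit _ _) (eulerf_unit _) E).
Qed.

(** * Convolution and the sign pattern *)

Lemma a_1p4_2m2_4m1E n : a_1p4_2m2_4m1 n =
  \sum_(i < n.+1) (gauss_theta ^+ 2).[[i]] * (eulerf 4)^-1.[[n - i]].
Proof.
rewrite /a_1p4_2m2_4m1 -coef_fpsM; congr (_.[[_]]).
rewrite /gauss_theta expr_div_n -exprM invrM ?unitrX ?eulerf_unit //.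
by rewrite -[RHS]mulrA; congr (_ * _); rewrite mulrC.
Qed.

Lemma a_1p4_2m2_4m1_sign n :
  (n %% 4 < 3)%N -> 0 < (-1) ^+ n * a_1p4_2m2_4m1 n.
Proof.
move=> n4; rewrite a_1p4_2m2_4m1E mulr_sumr.
have term (i : 'I_n.+1) : (4 %| n - i)%N ->
    (-1) ^+ n * ((gauss_theta ^+ 2).[[i]] * (eulerf 4)^-1.[[n - i]])
    = ((-1) ^+ i * (gauss_theta ^+ 2).[[i]]) * (eulerf 4)^-1.[[n - i]].
  move=> dvd4; rewrite mulrA; congr (_ * _ * _).
  by rewrite -signr_odd -[RHS]signr_odd; congr (_ ^+ _); move: (ltn_ord i); lia.
have lt_r : (n %% 4 < n.+1)%N by rewrite ltnS leq_mod.
(* The term [i = n mod 4] is strictly positive, as this residue is 0, 1 or 2 and [n - i] is a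
   multiple of 4; all other terms are nonnegative. *)
rewrite (bigD1 (Ordinal lt_r)) //= ltr_wpDr //.
  rewrite sumr_ge0 // => i _; have := eulerf4_inv_pos (n - i)%N.
  case: ifP => [dvd4 /ltW g_ge0|_ ->]; last by rewrite !mulr0.
  by rewrite term // mulr_ge0 ?coef_gauss_theta_sqr_ge0.
have dvd4 : (4 %| n - n %% 4)%N by lia.
rewrite (term (Ordinal lt_r)) //=; have := eulerf4_inv_pos (n - n %% 4)%N.
by rewrite dvd4 => g_gt0; rewrite mulr_gt0 ?coef_gauss_theta_sqr_gt0.
Qed.

Lemma a_1p4_2m2_4m1_mod4 n : (n %% 4 = 3)%N -> a_1p4_2m2_4m1 n = 0.
Proof.
move=> n4; rewrite a_1p4_2m2_4m1E big1 // => i _.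
have := eulerf4_inv_pos (n - i)%N; case: ifP => [dvd4 _|_ ->]; last exact: mulr0.
rewrite coef_gauss_theta_sqr_mod4 ?mul0r //.
by move: (ltn_ord i); lia.
Qed.

Theorem theorem4p10 (n : nat) :
  0 < a_1p4_2m2_4m1 (2 * n)%N /\
  a_1p4_2m2_4m1 (4 * n + 1)%N < 0 /\
  a_1p4_2m2_4m1 (4 * n + 3)%N = 0.
Proof.
split; last split.
- have := @a_1p4_2m2_4m1_sign (2 * n)%N; rewrite -signr_odd oddM /= mul1r.
  by apply; lia.
- have := @a_1p4_2m2_4m1_sign (4 * n + 1)%N; rewrite -signr_odd oddD oddM /=.
  by rewrite expr1 mulN1r oppr_gt0; apply; lia.
- by apply: a_1p4_2m2_4m1_mod4; lia.
Qed.
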